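(* Let $R$ be a commutative ring with identity and let $\mathcal{M}$ and $\mathcal{M}'$ be two homotopically equivalent complexes of $R$-modules. Then for every $n\ge 0$, the $\mathcal{R}(R)$-semimodules $H_n(\mathcal{R}(\mathcal{M}))$ and $H_n(\mathcal{R}(\mathcal{M}'))$ are isomorphic.
   Context: For an $R$-module $M$ and a submodule $N\subseteq M$, $\operatorname{rad}(N)$ is the intersection of all prime submodules of $M$ containing $N$ (and $\operatorname{rad}(N)=M$ if there is none); a submodule $P\subsetneq M$ is prime if $rm\in P$ ($r\in R$, $m\in M$) implies $m\in P$ or $rM\subseteq P$. $N$ is a radical submodule if $\operatorname{rad}(N)=N$. For an ideal $I$ of $R$, $\sqrt I$ is its usual radical. $\mathcal{R}(R)$ is the set of radical ideals of $R$, a commutative semiring with sum $\sqrt{I+J}$ and product $\sqrt{IJ}$. $\mathcal{R}(M)$ is the set of radical submodules of $M$, an $\mathcal{R}(R)$-semimodule with addition $\operatorname{rad}(N+L)$ and scalar action $\operatorname{rad}(IN)$; its zero element is $\operatorname{rad}(0)$. For an $R$-module homomorphism $f:M\to M'$, $\mathcal{R}(f):\mathcal{R}(M)\to\mathcal{R}(M')$ is the $\mathcal{R}(R)$-semimodule homomorphism $\mathcal{R}(f)(N)=\operatorname{rad}(f(N))$. It is known that $\mathcal{R}$ is a covariant functor from $R$-modules to $\mathcal{R}(R)$-semimodules. A complex $\mathcal{M}=(M_n,f_n)_{n\ge 0}$ of $R$-modules is a sequence of modules with homomorphisms $f_n:M_n\to M_{n-1}$ ($M_{-1}=0$) and $f_nf_{n+1}=0$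 for all $n\geq 0$. A map of complexes is a family of homomorphisms in each degree commuting with the boundary maps. Two maps of complexes $\phi,\psi:(M_n,f_n)\to(M'_n,f'_n)$ of $R$-modules are homotopic, $\phi\simeq\psi$, if there are $R$-module homomorphisms $s_n:M_n\to M'_{n+1}$ with $\phi_n+s_{n-1}f_n+f'_{n+1}s_n=\psi_n$ for all $n\ge 0$ ($s_{-1}=0$). Complexes $\mathcal{M},\mathcal{M}'$ of $R$-modules are homotopically equivalent if there exist maps of complexes $\phi:\mathcal{M}\to\mathcal{M}'$ and $\psi:\mathcal{M}'\to\mathcal{M}$ with $\phi\psi\simeq I_{\mathcal{M}'}$ and $\psi\phi\simeq I_{\mathcal{M}}$. $Z_n(\mathcal{R}(\mathcal{M}))=\operatorname{Ker}\mathcal{R}(f_n)$ (elements mapped to the zero element) and $B_n(\mathcal{R}(\mathcal{M}))=\operatorname{Im}\mathcal{R}(f_{n+1})\subseteq Z_n(\mathcal{R}(\mathcal{M}))$. For a subsemimodule $\mathsf{N}$ of a semimodule $\mathsf{M}$, the Bourne relation is $m\equiv_{\mathsf{N}}m'$ iff $m+n=m'+n'$ for some $n,n'\in\mathsf{N}$; the set of classes $\mathsf{M}/\mathsf{N}$ is a semimodule with the induced operations. $H_n(\mathcal{R}(\mathcal{M}))=Z_n(\mathcal{R}(\mathcal{M}))/B_n(\mathcal{R}(\mathcal{M}))$. *)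

(* Defs.v *)
From HB Require Import structures.
From mathcomp Require Import all_boot all_order all_algebra.
From mathcomp Require Import all_classical.

Set Implicit Arguments.
Unset Strict Implicit.
Unset Printing Implicit Defensive.

Import GRing.Theory.
Local Open Scope classical_set_scope.
Local Open Scope ring_scope.
Local Open Scope quotient_scope.

Section Submodules.
Variables (R : comPzRingType) (M : lmodType R).
Implicit Types (N L P : set M) (I : set R).

Definition submodule N : Prop := submod_closed (mem N).

Definition prime_submodule P : Prop :=
  [/\ submodule P, P != setT
    & forall (r : R) (m : M),
        P (r *: m) -> P m \/ [set r *: x | x in setT] `<=` P].

(* With no prime submodule above N this is the empty intersection setT. *)
Definition rad_set N : set M :=
  \bigcap_(P in [set P | prime_submodule P /\ N `<=` P]) P.

Definition radical_submodule N : Prop := submodule N /\ rad_set N = N.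

Definition sum_set N L : set M := [set x | exists2 y, N y & exists2 z, L z & x = y + z].

(* IN: the finite sums of products r m with r in I and m in N. *)
Definition scale_set I N : set M :=
  [set x | exists2 s : seq (R * M),
     {in s, forall p, I p.1 /\ N p.2} & x = \sum_(p <- s) p.1 *: p.2].

End Submodules.

Section Ideals.
Variable R : comPzRingType.
Implicit Types I J : set R.

(* Not ring_quotient's idealr_closed, which excludes the unit ideal. *)
Definition ideal I : Prop := @submodule R R^o I.

Definition sqrt_ideal I : set R := [set x | exists k, I (x ^+ k)].

Definition radical_ideal I : Prop := ideal I /\ sqrt_ideal I = I.

Definition sum_ideal I J : set R := @sum_set R R^o I J.

Definition mul_ideal I J : set R := @scale_set R R^o I J.

End Ideals.

Section SubmoduleTheory.
Variable R : comPzRingType.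
Implicit Types (M : lmodType R).

Lemma submoduleP M (N : set M) :
  submodule N <-> N 0 /\ forall a x y, N x -> N y -> N (a *: x + y).
Proof.
split=> -[N0 NL]; split; first by move: N0; rewrite inE.
- by move=> a x y Nx Ny; have := NL a x y; rewrite !inE; apply.
- by rewrite inE.
- by move=> a x y; rewrite !inE; apply: NL.
Qed.

Lemma submodule0 M (N : set M) : submodule N -> N 0.
Proof. by case/submoduleP. Qed.

Lemma submoduleD M (N : set M) x y : submodule N -> N x -> N y -> N (x + y).
Proof. by case/submoduleP=> _ NL; rewrite -{2}[x]scale1r; apply: NL. Qed.

Lemma submoduleZ M (N : set M) a x : submodule N -> N x -> N (a *: x).
Proof.
by case/submoduleP=> N0 NL Nx; rewrite -[_ *: _]addr0; apply: NL.
Qed.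

Lemma submodule_sum M (N : set M) (T : eqType) (s : seq T) (F : T -> M) :
  submodule N -> {in s, forall i, N (F i)} -> N (\sum_(i <- s) F i).
Proof.
move=> sN NF; rewrite big_seq; elim/big_ind: _ => //.
- exact: submodule0.
- by move=> x y; apply: submoduleD.
Qed.

Lemma submodule_setT M : submodule [set: M].
Proof. exact/submoduleP. Qed.

Lemma submodule_set0 M : submodule [set (0 : M)].
Proof.
by apply/submoduleP; split=> // a x y -> -> /=; rewrite scaler0 addr0.
Qed.

Lemma submodule_sum_set M (N L : set M) :
  submodule N -> submodule L -> submodule (sum_set N L).
Proof.
move=> sN sL; apply/submoduleP; split.
  by exists 0; [exact: submodule0 | exists 0; [exact: submodule0 | rewrite addr0]].
move=> a _ _ [x Nx [y Ly ->]] [z Nz [t Lt ->]].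
exists (a *: x + z); first by apply: submoduleD => //; apply: submoduleZ.
exists (a *: y + t); first by apply: submoduleD => //; apply: submoduleZ.
by rewrite scalerDr addrACA.
Qed.

Lemma submodule_scale_set M (I : set R) (N : set M) :
  submodule N -> submodule (scale_set I N).
Proof.
move=> sN; apply/submoduleP; split; first by exists [::]; rewrite ?big_nil.
move=> a _ _ [s sIN ->] [t tIN ->].
exists ([seq (p.1, a *: p.2) | p <- s] ++ t).
  move=> p; rewrite mem_cat => /orP[/mapP[q /sIN[Iq Nq] ->]|/tIN //].
  by split=> //=; apply: submoduleZ.
rewrite big_cat big_map scaler_sumr /=; congr (_ + _).
by apply: eq_bigr => p _; rewrite !scalerA mulrC.
Qed.

Lemma scale_set_sub M (I : set R) (N L : set M) : submodule L ->
  scale_set I N `<=` L <-> (forall r x, I r -> N x -> L (r *: x)).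
Proof.
move=> sL; split=> [sub r x Ir Nx|sub _ [s sIN ->]].
  apply: sub; exists [:: (r, x)]; last by rewrite big_seq1.
  by move=> p; rewrite inE => /eqP->.
by apply: submodule_sum => // p /sIN[]; apply: sub.
Qed.

Lemma sum_set_sub M (N L K : set M) : submodule N -> submodule L ->
  submodule K -> sum_set N L `<=` K <-> N `<=` K /\ L `<=` K.
Proof.
move=> sN sL sK; split=> [sub|[NK LK] _ [x Nx [y Ly ->]]]; last first.
  by apply: submoduleD => //; [apply: NK | apply: LK].
split=> x xN; apply: sub.
  by exists x => //; exists 0; [exact: submodule0 | rewrite addr0].
by exists 0; [exact: submodule0 | exists x => //; rewrite add0r].
Qed.

Lemma submodule_rad M (N : set M) : submodule (rad_set N).
Proof.
apply/submoduleP; split=> [P [[sP _ _] _]|a x y Nx Ny P PP].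
  exact: submodule0.
have [[sP _ _] _] := PP.
by apply: submoduleD => //; [apply: submoduleZ => //; apply: Nx | apply: Ny].
Qed.

Lemma sub_rad M (N : set M) : N `<=` rad_set N.
Proof. by move=> x Nx P [_]; apply. Qed.

Lemma rad_sub M (N L : set M) : radical_submodule L ->
  rad_set N `<=` L <-> N `<=` L.
Proof.
case=> _ rL; split=> [|NL]; first by move=> h x /sub_rad /h.
rewrite -rL => x Nx P [pP LP]; apply: Nx; split=> //.
exact: subset_trans LP.
Qed.

Lemma radical_rad M (N : set M) : radical_submodule (rad_set N).
Proof.
split; first exact: submodule_rad.
apply/seteqP; split; last exact: sub_rad.
move=> x Nx P [pP NP]; apply: Nx; split=> // y; apply.
by split.
Qed.

Lemma radical_setT M : radical_submodule [set: M].
Proof.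
split; first exact: submodule_setT.
by apply/seteqP; split=> // x _; apply: sub_rad.
Qed.

Lemma radical_preimage M M' (f : {linear M -> M'}) (L : set M') :
  radical_submodule L -> radical_submodule (f @^-1` L).
Proof.
move=> [sL rL]; split.
  apply/submoduleP; split=> [|a x y]; rewrite /preimage /=.
    by rewrite linear0; apply: submodule0.
  rewrite linearP => Lx Ly.
  by apply: submoduleD => //; apply: submoduleZ.
apply/seteqP; split; last exact: sub_rad.
move=> x radx; rewrite /preimage /= -rL => P [[sP PT pP] LP].
have [fP|fP] := EM (f @^-1` P = setT).
  by have : (f @^-1` P) x by rewrite fP.
apply: (radx (f @^-1` P)); split; last by move=> y; apply: LP.
split.
- apply/submoduleP; split=> [|a y z]; rewrite /preimage /=.
    by rewrite linear0; apply: submodule0.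
  rewrite linearP => Py Pz.
  by apply: submoduleD => //; apply: submoduleZ.
- exact/eqP.
move=> r m; rewrite /preimage /= linearZ => /pP[|rP]; first by left.
right=> _ [y _ <-]; rewrite /= linearZ /=; apply: rP.
by exists (f y).
Qed.

Lemma radical_scale M (L : set M) r x k :
  radical_submodule L -> L (r ^+ k *: x) -> L (r *: x).
Proof.
move=> [sL rL] Lx; rewrite -rL => P [[sP _ pP] LP].
elim: k Lx => [|k IHk].
  by rewrite expr0 scale1r => /LP Px; apply: submoduleZ.
move=> /LP; rewrite exprS -scalerA => /pP[]; last by apply; exists x.
have {}IHk : P (r ^+ k *: x) -> P (r *: x).
  elim: k {IHk} => [|k IHk]; first by rewrite expr0 scale1r; apply: submoduleZ.
  by rewrite exprS -scalerA => /pP[//|]; apply; exists x.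
exact: IHk.
Qed.

Lemma ideal_sqrt (I : set R) : ideal I -> ideal (sqrt_ideal I).
Proof.
move=> sI; apply/submoduleP; split.
  by exists 1%N; rewrite expr1; apply: (submodule0 sI).
move=> a x y [m Ix] [n Iy]; exists (m + n)%N.
rewrite exprDn; apply: (@submodule_sum R^o I _ _ _ sI) => i _.
have mI u v : I v -> I (u * v) by exact: (@submoduleZ R^o I u v sI).
rewrite -mulr_natl; apply: (mI).
case: (leqP n i) => [ni|/ltnW ni]; first by rewrite -(subnK ni) exprD mulrA; apply: mI.
rewrite -[a *: x]/(a * x) -addnBA // exprD exprMn -!mulrA mulrCA mulrC.
exact: mI.
Qed.

Lemma sub_sqrt (I : set R) : I `<=` sqrt_ideal I.
Proof. by move=> x Ix; exists 1%N; rewrite expr1. Qed.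

Lemma sqrt_sub (I J : set R) : radical_ideal J ->
  sqrt_ideal I `<=` J <-> I `<=` J.
Proof.
case=> _ rJ; split=> [|IJ]; first by move=> h x /sub_sqrt /h.
by rewrite -rJ => x [k /IJ]; exists k.
Qed.

Lemma radical_sqrt (I : set R) : ideal I -> radical_ideal (sqrt_ideal I).
Proof.
move=> sI; split; first exact: ideal_sqrt.
apply/seteqP; split; last exact: sub_sqrt.
by move=> x [k [l]]; rewrite -exprM; exists (k * l)%N.
Qed.

Lemma radical_idealT : radical_ideal [set: R].
Proof.
split; first exact: submodule_setT.
by apply/seteqP; split=> // x _; apply: sub_sqrt.
Qed.

Lemma radical_colon M (L : set M) (x : M) :
  radical_submodule L -> radical_ideal [set r | L (r *: x)].
Proof.
move=> rL; have [sL _] := rL; split.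
  apply/submoduleP; split=> /=; first by rewrite scale0r; apply: submodule0.
  move=> a b c Lb Lc; rewrite scalerDl -[a *: b]/(a * b) -scalerA.
  by apply: submoduleD => //; apply: submoduleZ.
apply/seteqP; split; last exact: sub_sqrt.
by move=> r [k]; apply: radical_scale.
Qed.

Lemma radical_ideal_colon (J : set R) (x : R) :
  radical_ideal J -> radical_ideal [set r | J (r * x)].
Proof.
move=> [sJ rJ]; split.
  apply/submoduleP; split=> /=; first by rewrite mul0r; apply: (submodule0 sJ).
  move=> a b c Jb Jc; rewrite mulrDl -[a *: b]/(a * b) -mulrA.
  exact: (@submoduleD R^o J _ _ sJ (@submoduleZ R^o J a _ sJ Jb)).
apply/seteqP; split; last exact: sub_sqrt.
move=> r [k] /= Jk; rewrite -rJ; exists k.+1.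
rewrite exprMn !exprS (mulrC x) mulrACA.
exact: (@submoduleZ R^o J (r * x ^+ k) _ sJ Jk).
Qed.

End SubmoduleTheory.

Record radIdeal (R : comPzRingType) := RadIdeal {
  radIdeal_set :> set R;
  radIdealP : radical_ideal radIdeal_set }.

HB.instance Definition _ (R : comPzRingType) := gen_eqMixin (radIdeal R).
HB.instance Definition _ (R : comPzRingType) := gen_choiceMixin (radIdeal R).

Section RadIdealSemiring.
Variable R : comPzRingType.
Implicit Types I J K : radIdeal R.

Lemma radIdeal_eq I J : I = J :> set R -> I = J.
Proof.
by case: I J => [I rI] [J rJ] /= eIJ; subst J; rewrite (Prop_irrelevance rI rJ).
Qed.

Lemma radIdeal_ideal I : ideal I. Proof. by case: (radIdealP I). Qed.

Definition radIdeal_add I J : radIdeal R :=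
  RadIdeal (radical_sqrt
    (submodule_sum_set (radIdeal_ideal I) (radIdeal_ideal J))).

Definition radIdeal_zero : radIdeal R :=
  RadIdeal (radical_sqrt (@submodule_set0 R R^o)).

Definition radIdeal_mul I J : radIdeal R :=
  RadIdeal (radical_sqrt
    (@submodule_scale_set R R^o I _ (radIdeal_ideal J))).

Definition radIdeal_one : radIdeal R := RadIdeal (radical_idealT R).

Lemma radIdeal_eq_ub I J :
  (forall K, I `<=` K <-> J `<=` K) -> I = J.
Proof.
move=> ub; apply: radIdeal_eq; apply/seteqP; split; first exact/ub.
exact/(ub I).
Qed.

Lemma radIdeal_add_sub I J K :
  radIdeal_add I J `<=` K <-> I `<=` K /\ J `<=` K.
Proof.
rewrite sqrt_sub; last exact: radIdealP.
by apply: (@sum_set_sub R R^o); apply: radIdeal_ideal.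
Qed.

Lemma radIdeal_zero_sub K : radIdeal_zero `<=` K.
Proof.
apply/sqrt_sub; first exact: radIdealP.
by move=> x ->; apply: (@submodule0 R R^o); apply: radIdeal_ideal.
Qed.

Lemma radIdeal_mul_sub I J K :
  radIdeal_mul I J `<=` K <-> forall x y, (I : set R) x -> (J : set R) y -> (K : set R) (x * y).
Proof.
rewrite sqrt_sub; last exact: radIdealP.
by apply: (@scale_set_sub R R^o); apply: radIdeal_ideal.
Qed.

Definition radIdeal_colon K (x : R) : radIdeal R :=
  RadIdeal (radical_ideal_colon x (radIdealP K)).

Lemma radIdeal_mul_colon I J K :
  radIdeal_mul I J `<=` K <-> forall y, (J : set R) y -> I `<=` radIdeal_colon K y.
Proof.
rewrite radIdeal_mul_sub; split=> [h y Jy x Ix|h x y Ix Jy].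
  exact: h.
exact: h Jy x Ix.
Qed.

Lemma radIdeal_addA : associative radIdeal_add.
Proof.
by move=> I J K; apply: radIdeal_eq_ub => L; rewrite !radIdeal_add_sub; tauto.
Qed.

Lemma radIdeal_addC : commutative radIdeal_add.
Proof.
by move=> I J; apply: radIdeal_eq_ub => L; rewrite !radIdeal_add_sub; tauto.
Qed.

Lemma radIdeal_add0 : left_id radIdeal_zero radIdeal_add.
Proof.
move=> I; apply: radIdeal_eq_ub => L; rewrite radIdeal_add_sub.
by have := @radIdeal_zero_sub L; tauto.
Qed.

Lemma radIdeal_mulC : commutative radIdeal_mul.
Proof.
move=> I J; apply: radIdeal_eq_ub => L; rewrite !radIdeal_mul_sub.
by split=> h x y xI yJ; rewrite mulrC; apply: h.
Qed.

Lemma radIdeal_mulA : associative radIdeal_mul.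
Proof.
move=> I J K; apply: radIdeal_eq_ub => L.
rewrite [radIdeal_mul I _]radIdeal_mulC !radIdeal_mul_colon; split.
- move=> h z Kz; apply/radIdeal_mul_sub => x y Ix Jy /=.
  have /radIdeal_mul_sub := h x Ix.
  by move=> /(_ y z Jy Kz) /=; rewrite mulrC mulrA.
move=> h x Ix; apply/radIdeal_mul_sub => y z Jy Kz /=.
have /radIdeal_mul_sub := h z Kz.
by move=> /(_ x y Ix Jy) /=; rewrite -mulrA mulrC.
Qed.

Lemma radIdeal_mul1 : left_id radIdeal_one radIdeal_mul.
Proof.
move=> I; apply: radIdeal_eq_ub => L; rewrite radIdeal_mul_sub.
split=> [h x Ix|h x y _ /h Ly]; first by rewrite -[x]mul1r; apply: h.
exact: (@submoduleZ R R^o L x y (radIdeal_ideal L) Ly).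
Qed.

Lemma radIdeal_mulDl : left_distributive radIdeal_mul radIdeal_add.
Proof.
move=> I J K; apply: radIdeal_eq_ub => L.
rewrite radIdeal_add_sub !radIdeal_mul_colon; split.
  by move=> h; split=> y /h /radIdeal_add_sub[].
by move=> [hI hJ] y Ky; apply/radIdeal_add_sub; split; [apply: hI|apply: hJ].
Qed.

Lemma radIdeal_mul0 : left_zero radIdeal_zero radIdeal_mul.
Proof.
move=> I; apply: radIdeal_eq_ub => L; rewrite radIdeal_mul_colon.
by split=> // _; [apply: radIdeal_zero_sub | move=> y _; apply: radIdeal_zero_sub].
Qed.

HB.instance Definition _ := GRing.isNmodule.Build (radIdeal R)
  radIdeal_addA radIdeal_addC radIdeal_add0.
HB.instance Definition _ := GRing.Nmodule_isComPzSemiRing.Build (radIdeal R)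
  radIdeal_mulA radIdeal_mulC radIdeal_mul1 radIdeal_mulDl radIdeal_mul0.

End RadIdealSemiring.

Record radSubmod (R : comPzRingType) (M : lmodType R) := RadSubmod {
  radSubmod_set :> set M;
  radSubmodP : radical_submodule radSubmod_set }.

HB.instance Definition _ (R : comPzRingType) (M : lmodType R) :=
  gen_eqMixin (radSubmod M).
HB.instance Definition _ (R : comPzRingType) (M : lmodType R) :=
  gen_choiceMixin (radSubmod M).

Section RadSubmodSemimodule.
Variables (R : comPzRingType) (M : lmodType R).
Implicit Types (N L K : radSubmod M) (I J : radIdeal R).

Lemma radSubmod_eq N L : N = L :> set M -> N = L.
Proof.
by case: N L => [N rN] [L rL] /= eNL; subst L; rewrite (Prop_irrelevance rN rL).
Qed.

Lemma radSubmod_sub N : submodule N. Proof. by case: (radSubmodP N). Qed.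

Definition radSubmod_add N L : radSubmod M := RadSubmod (radical_rad (sum_set N L)).

Definition radSubmod_zero : radSubmod M := RadSubmod (radical_rad [set 0]).

Definition radSubmod_scale I N : radSubmod M :=
  RadSubmod (radical_rad (scale_set I N)).

Lemma radSubmod_eq_ub N L : (forall K, N `<=` K <-> L `<=` K) -> N = L.
Proof.
move=> ub; apply: radSubmod_eq; apply/seteqP; split; first exact/ub.
exact/(ub N).
Qed.

Lemma radSubmod_add_sub N L K :
  radSubmod_add N L `<=` K <-> N `<=` K /\ L `<=` K.
Proof.
rewrite rad_sub; last exact: radSubmodP.
by apply: sum_set_sub; apply: radSubmod_sub.
Qed.

Lemma radSubmod_zero_sub K : radSubmod_zero `<=` K.
Proof.
apply/rad_sub; first exact: radSubmodP.
by move=> x ->; apply: submodule0; apply: radSubmod_sub.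
Qed.

Lemma radSubmod_scale_sub I N K :
  radSubmod_scale I N `<=` K <-> forall r x,
    (I : set R) r -> (N : set M) x -> (K : set M) (r *: x).
Proof.
rewrite rad_sub; last exact: radSubmodP.
by apply: scale_set_sub; apply: radSubmod_sub.
Qed.

Definition radSubmod_colon K (x : M) : radIdeal R :=
  RadIdeal (radical_colon x (radSubmodP K)).

Definition radSubmod_preim_scale K (r : R) : radSubmod M :=
  RadSubmod (radical_preimage (r \*: idfun)%R (radSubmodP K)).

Lemma radSubmod_scale_colon I N K :
  radSubmod_scale I N `<=` K <-> forall x, (N : set M) x -> I `<=` radSubmod_colon K x.
Proof.
rewrite radSubmod_scale_sub; split=> [h x Nx r Ir|h r x Ir Nx].
  exact: h.
exact: h Nx r Ir.
Qed.

Lemma radSubmod_scale_preim I N K :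
  radSubmod_scale I N `<=` K <->
  forall r, (I : set R) r -> N `<=` radSubmod_preim_scale K r.
Proof.
rewrite radSubmod_scale_sub; split=> [h r Ir x Nx|h r x Ir Nx].
  exact: h.
exact: h Ir x Nx.
Qed.

Lemma radSubmod_addA : associative radSubmod_add.
Proof.
by move=> N L K; apply: radSubmod_eq_ub => A; rewrite !radSubmod_add_sub; tauto.
Qed.

Lemma radSubmod_addC : commutative radSubmod_add.
Proof.
by move=> N L; apply: radSubmod_eq_ub => A; rewrite !radSubmod_add_sub; tauto.
Qed.

Lemma radSubmod_add0 : left_id radSubmod_zero radSubmod_add.
Proof.
move=> N; apply: radSubmod_eq_ub => A; rewrite radSubmod_add_sub.
by have := @radSubmod_zero_sub A; tauto.
Qed.

HB.instance Definition _ := GRing.isNmodule.Build (radSubmod M)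
  radSubmod_addA radSubmod_addC radSubmod_add0.

Lemma radSubmod_scaleA I J N :
  radSubmod_scale I (radSubmod_scale J N) = radSubmod_scale (I * J) N.
Proof.
apply: radSubmod_eq_ub => K.
rewrite radSubmod_scale_preim radSubmod_scale_colon; split.
- move=> h x Nx; apply/radIdeal_mul_sub => a b Ia Jb /=.
  by have /radSubmod_scale_sub/(_ b x Jb Nx) /= := h a Ia; rewrite -scalerA.
move=> h a Ia; apply/radSubmod_scale_sub => b x Jb Nx /=.
by have /radIdeal_mul_sub/(_ a b Ia Jb) /= := h x Nx; rewrite -scalerA.
Qed.

Lemma radSubmod_scale0 N : radSubmod_scale 0 N = 0.
Proof.
apply: radSubmod_eq_ub => K; rewrite radSubmod_scale_colon.
by split=> [_|_ x _]; [apply: radSubmod_zero_sub | apply: radIdeal_zero_sub].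
Qed.

Lemma radSubmod_scale1 : left_id 1 radSubmod_scale.
Proof.
move=> N; apply: radSubmod_eq_ub => K; rewrite radSubmod_scale_sub.
split=> [h x Nx|h r x _ /h Kx]; first by rewrite -[x]scale1r; apply: h.
by apply: submoduleZ => //; apply: radSubmod_sub.
Qed.

Lemma radSubmod_scaleDr : right_distributive radSubmod_scale +%R.
Proof.
move=> I N L; apply: radSubmod_eq_ub => K.
rewrite radSubmod_add_sub !radSubmod_scale_preim; split.
  by move=> h; split=> r /h /radSubmod_add_sub[].
by move=> [hN hL] r Ir; apply/radSubmod_add_sub; split; [apply: hN|apply: hL].
Qed.

Lemma radSubmod_scaleDl N : {morph radSubmod_scale^~ N : I J / I + J}.
Proof.
move=> I J; apply: radSubmod_eq_ub => K.
rewrite radSubmod_add_sub !radSubmod_scale_colon; split.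
  by move=> h; split=> x /h /radIdeal_add_sub[].
by move=> [hI hJ] x Nx; apply/radIdeal_add_sub; split; [apply: hI|apply: hJ].
Qed.

HB.instance Definition _ := GRing.Nmodule_isLSemiModule.Build (radIdeal R)
  (radSubmod M) radSubmod_scaleA radSubmod_scale0 radSubmod_scale1
  radSubmod_scaleDr radSubmod_scaleDl.

End RadSubmodSemimodule.

Section RadMap.
Variables (R : comPzRingType) (M M' : lmodType R) (f : {linear M -> M'}).

Definition radMap (N : radSubmod M) : radSubmod M' :=
  RadSubmod (radical_rad (f @` N)).

Lemma radMap_sub (N : radSubmod M) (L : radSubmod M') :
  radMap N `<=` L <-> N `<=` f @^-1` L.
Proof.
rewrite rad_sub; last exact: radSubmodP.
by split=> [h x Nx|h _ [x Nx <-]]; [apply: h; exists x | apply: h].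
Qed.

Lemma radMap_semilinear : semilinear radMap.
Proof.
pose pre (L : radSubmod M') := RadSubmod (radical_preimage f (radSubmodP L)).
have radMap_pre (N : radSubmod M) (L : radSubmod M') :
    radMap N `<=` L <-> N `<=` pre L by exact: radMap_sub.
split=> [I N|N N']; apply: radSubmod_eq_ub => L; rewrite radMap_pre.
- rewrite radSubmod_scale_sub radSubmod_scale_preim.
  split=> [h r Ir|h r x Ir Nx].
    apply/radMap_sub => x Nx; have := h r x Ir Nx.
    by rewrite /preimage /= linearZ.
  have /radMap_sub/(_ x Nx) := h r Ir.
  by rewrite /preimage /= linearZ.
by rewrite !radSubmod_add_sub !radMap_pre.
Qed.

HB.instance Definition _ := GRing.isSemilinear.Build (radIdeal R)
  (radSubmod M) (radSubmod M') *:%R radMap radMap_semilinear.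

End RadMap.

Lemma radMap_comp0 (R : comPzRingType) (M M' M'' : lmodType R)
    (f : {linear M' -> M''}) (g : {linear M -> M'}) (N : radSubmod M) :
  (forall x, f (g x) = 0) -> radMap f (radMap g N) = 0.
Proof.
move=> fg0; apply: radSubmod_eq; apply/seteqP.
split; last exact: radSubmod_zero_sub.
apply/(@radMap_sub _ _ _ f _ (radSubmod_zero M'')).
apply/(@radMap_sub _ _ _ g _ (RadSubmod (radical_preimage f (radSubmodP (radSubmod_zero M''))))).
move=> x _; rewrite /preimage /= fg0.
by apply: submodule0; apply: submodule_rad.
Qed.

Section Subsemimodules.
Variables (S : pzSemiRingType) (V : lSemiModType S).

Record subsemimod (N : submodClosed V) := Subsemimod {
  subsemimod_val : V;
  subsemimod_valP : subsemimod_val \in N }.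

HB.instance Definition _ (N : submodClosed V) :=
  [isSub for @subsemimod_val N].
HB.instance Definition _ (N : submodClosed V) :=
  [Choice of subsemimod N by <:].
HB.instance Definition _ (N : submodClosed V) :=
  GRing.SubChoice_isSubLSemiModule.Build S V (mem N) (subsemimod N)
    (GRing.subsemimodClosedP N).

End Subsemimodules.

Section Kernel.
Variables (S : pzSemiRingType) (U V : lSemiModType S) (f : {linear U -> V}).

Definition semiker : {pred U} := [pred x | f x == 0].

Lemma semiker_closed : subsemimod_closed semiker.
Proof.
split; [split|] => [|x y|a x]; rewrite !inE.
- by rewrite linear0.
- by move=> /eqP fx /eqP fy; rewrite linearD fx fy addr0.
by move=> /eqP fx; rewrite linearZ /= fx scaler0.
Qed.

HB.instance Definition _ := GRing.isSubSemiModClosed.Build S U semiker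
  semiker_closed.

End Kernel.

Section Image.
Variables (S : pzSemiRingType) (W U : lSemiModType S) (g : {linear W -> U}).
Variable Z : submodClosed U.

(* Im g cut down to Z; it is all of Im g when Im g lies in Z. *)
Definition im_in : {pred subsemimod Z} := [pred z | `[< range g (val z) >]].

Lemma im_in_closed : subsemimod_closed im_in.
Proof.
split; [split|] => [|x y|a x]; rewrite !inE.
- by exists 0; rewrite // linear0 GRing.val0.
- move=> [u _ gu] [v _ gv].
  by exists (u + v) => //; rewrite linearD gu gv GRing.valD.
move=> [u _ gu]; exists (a *: u) => //.
by rewrite !linearZ /= gu.
Qed.

HB.instance Definition _ := GRing.isSubSemiModClosed.Build S (subsemimod Z)
  im_in im_in_closed.

End Image.

Arguments im_in {S W U} g Z.

Section Bourne.
Variables (S : pzSemiRingType) (V : lSemiModType S) (N : submodClosed V).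
Implicit Types x y z : V.

Definition bourne : rel V := fun x y =>
  `[< exists n n', [/\ n \in N, n' \in N & x + n = y + n'] >].

Lemma bourne_refl : reflexive bourne.
Proof. by move=> x; apply/asboolP; exists 0, 0; rewrite rpred0. Qed.

Lemma bourne_sym : symmetric bourne.
Proof.
by move=> x y; apply/asboolP/asboolP=> -[n [n' [Nn Nn' e]]]; exists n', n.
Qed.

Lemma bourne_trans : transitive bourne.
Proof.
move=> y x z /asboolP[n [n' [Nn Nn' e]]] /asboolP[k [k' [Nk Nk' e']]].
apply/asboolP; exists (n + k), (k' + n').
by split; rewrite ?rpredD // !addrA e -e' addrAC.
Qed.

Canonical bourne_equiv := EquivRel bourne bourne_refl bourne_sym bourne_trans.

Definition bourne_quot := {eq_quot bourne_equiv}.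

HB.instance Definition _ := Choice.on bourne_quot.
HB.instance Definition _ := EqQuotient.on bourne_quot.

Lemma bourne_quotP x y :
  reflect (exists n n', [/\ n \in N, n' \in N & x + n = y + n'])
          (\pi_bourne_quot x == \pi_bourne_quot y).
Proof. by rewrite eqmodE; apply: asboolP. Qed.

Definition bourne_zero : bourne_quot := lift_cst bourne_quot 0.
Definition bourne_add := lift_op2 bourne_quot +%R.
Definition bourne_scale (a : S) := lift_op1 bourne_quot ( *:%R a).

Canonical bourne_pi_zero := PiConst bourne_zero.

Lemma bourne_pi_addP : {morph \pi_bourne_quot : x y / x + y >-> bourne_add x y}.
Proof.
move=> x y; unlock bourne_add; apply/eqP/bourne_quotP.
case: (piP bourne_quot x) => x' /eqP/bourne_quotP[n [n' [Nn Nn' e]]].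
case: (piP bourne_quot y) => y' /eqP/bourne_quotP[k [k' [Nk Nk' e']]].
by exists (n + k), (n' + k'); split; rewrite ?rpredD // addrACA e e' addrACA.
Qed.
Canonical bourne_pi_add := PiMorph2 bourne_pi_addP.

Lemma bourne_pi_scaleP a :
  {morph \pi_bourne_quot : x / a *: x >-> bourne_scale a x}.
Proof.
move=> x; unlock bourne_scale; apply/eqP/bourne_quotP.
case: (piP bourne_quot x) => x' /eqP/bourne_quotP[n [n' [Nn Nn' e]]].
by exists (a *: n), (a *: n'); rewrite !rpredZ // -!scalerDr e.
Qed.
Canonical bourne_pi_scale a := PiMorph1 (bourne_pi_scaleP a).

Lemma bourne_addA : associative bourne_add.
Proof. by move=> x y z; rewrite -[x]reprK -[y]reprK -[z]reprK !piE addrA. Qed.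

Lemma bourne_addC : commutative bourne_add.
Proof. by move=> x y; rewrite -[x]reprK -[y]reprK !piE addrC. Qed.

Lemma bourne_add0 : left_id bourne_zero bourne_add.
Proof. by move=> x; rewrite -[x]reprK !piE add0r. Qed.

HB.instance Definition _ := GRing.isNmodule.Build bourne_quot
  bourne_addA bourne_addC bourne_add0.

Lemma bourne_scaleA a b v :
  bourne_scale a (bourne_scale b v) = bourne_scale (a * b) v.
Proof. by rewrite -[v]reprK !piE scalerA. Qed.

Lemma bourne_scale0 v : bourne_scale 0 v = 0.
Proof. by rewrite -[v]reprK -[RHS]/bourne_zero !piE scale0r. Qed.

Lemma bourne_scale1 : left_id 1 bourne_scale.
Proof. by move=> v; rewrite -[v]reprK !piE scale1r. Qed.

Lemma bourne_scaleDr : right_distributive bourne_scale +%R.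
Proof.
move=> a u v; rewrite -[+%R]/bourne_add -[u]reprK -[v]reprK.
by rewrite !piE scalerDr.
Qed.

Lemma bourne_scaleDl v : {morph bourne_scale^~ v : a b / a + b}.
Proof.
move=> a b; rewrite -[RHS]/(bourne_add _ _) -[v]reprK.
by rewrite !piE scalerDl.
Qed.

HB.instance Definition _ := GRing.Nmodule_isLSemiModule.Build S bourne_quot
  bourne_scaleA bourne_scale0 bourne_scale1 bourne_scaleDr bourne_scaleDl.

End Bourne.

Definition isomorphic_semimod (S : pzSemiRingType) (U V : lSemiModType S) : Prop :=
  exists f : {linear U -> V}, bijective f.

Section Complexes.
Variable R : comPzRingType.

(* Given (M_n)_{n >= 0}, [lower M n] is M_{n-1}, with M_{-1} the zero module. *)
Definition lower (M : nat -> lmodType R) (n : nat) : lmodType R :=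
  if n is m.+1 then M m else 'rV[R]_0.

(* [cbd n] is f_n : M_n -> M_{n-1}; f_0 is the map to the zero module. *)
Record complex := Complex {
  cmod :> nat -> lmodType R;
  cbd : forall n, {linear cmod n -> lower cmod n};
  cbdK : forall n (x : cmod n.+1), cbd n (cbd n.+1 x) = 0 }.

(* The family (phi_{n-1})_n, with phi_{-1} = 0. *)
Definition lower_map (M M' : nat -> lmodType R)
    (phi : forall n, {linear M n -> M' n}) (n : nat) :
    {linear lower M n -> lower M' n} :=
  match n with 0 => \0 | m.+1 => phi m end.

Record complex_map (M M' : complex) := ComplexMap {
  cmap :> forall n, {linear M n -> M' n};
  cmapP : forall n (x : M n),
    cbd M' n (cmap n x) = lower_map cmap n (cbd M n x) }.

(* The family (s_{n-1})_n, with s_{-1} = 0. *)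
Definition lower_homotopy (M M' : nat -> lmodType R)
    (s : forall n, {linear M n -> M' n.+1}) (n : nat) :
    {linear lower M n -> M' n} :=
  match n with 0 => \0 | m.+1 => s m end.

Definition homotopic (M M' : complex) (phi psi : complex_map M M') : Prop :=
  exists s : forall n, {linear M n -> M' n.+1},
    forall n (x : M n),
      phi n x + lower_homotopy s n (cbd M n x) + cbd M' n.+1 (s n x) = psi n x.

Lemma complex_id_subproof (M : complex) n (x : M n) :
  cbd M n ((idfun : {linear M n -> M n}) x) =
  lower_map (fun k => (idfun : {linear M k -> M k})) n (cbd M n x).
Proof. by case: n x => [|n] x //=; apply/rowP => -[]. Qed.

Definition complex_id (M : complex) : complex_map M M :=
  ComplexMap (@complex_id_subproof M).

Lemma complex_comp_subproof (M M' M'' : complex) (phi : complex_map M' M'')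
    (psi : complex_map M M') n (x : M n) :
  cbd M'' n ((phi n \o psi n : {linear M n -> M'' n}) x) =
  lower_map (fun k => (phi k \o psi k : {linear M k -> M'' k})) n (cbd M n x).
Proof. by rewrite /= !cmapP; case: n x. Qed.

Definition complex_comp (M M' M'' : complex) (phi : complex_map M' M'')
    (psi : complex_map M M') : complex_map M M'' :=
  ComplexMap (@complex_comp_subproof M M' M'' phi psi).

Definition homotopy_equivalent (M M' : complex) : Prop :=
  exists (phi : complex_map M M') (psi : complex_map M' M),
    homotopic (complex_comp phi psi) (complex_id M') /\
    homotopic (complex_comp psi phi) (complex_id M).

(* Z_n(R(M)) = Ker R(f_n) *)
Definition cycles (M : complex) (n : nat) : submodClosed (radSubmod (M n)) :=
  semiker (radMap (cbd M n)).

Lemma boundary_cycle (M : complex) n (N : radSubmod (M n.+1)) :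
  radMap (cbd M n.+1) N \in cycles M n.
Proof.
apply/eqP.
exact: (radMap_comp0 (f := cbd M n) (g := cbd M n.+1) N (@cbdK M n)).
Qed.

(* B_n(R(M)) = Im R(f_{n+1}); nothing is lost inside Z_n, by boundary_cycle. *)
Definition boundaries (M : complex) (n : nat) :
    submodClosed (subsemimod (cycles M n)) :=
  im_in (radMap (cbd M n.+1)) (cycles M n).

Definition homology (M : complex) (n : nat) : lSemiModType (radIdeal R) :=
  bourne_quot (boundaries M n).

End Complexes.

(* Main.v *)
From HB Require Import structures.
Require Import Defs.
From mathcomp Require Import all_boot all_order all_algebra.
From mathcomp Require Import all_classical.

(** A map of complexes phi induces a map on homology, since R(phi) preserves
    cycles and boundaries. Suppose phi x + s f x + f s x = psi x for all x, and
    let N be a cycle. Then f N lies in rad(0), hence so does s f N, and rad(0)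
    lies in every radical submodule; therefore
    R(phi)(N) + R(f)(R(s)(N)) = R(psi)(N) + R(f)(R(s)(N)), so that R(phi)(N) and
    R(psi)(N) are Bourne congruent modulo the boundaries. Homotopic maps thus
    agree on homology, and functoriality concludes. *)

Set Implicit Arguments.
Unset Strict Implicit.
Unset Printing Implicit Defensive.

Import GRing.Theory.
Local Open Scope classical_set_scope.
Local Open Scope ring_scope.
Local Open Scope quotient_scope.

Section RestrictedMap.
Variables (S : pzSemiRingType) (U V : lSemiModType S) (f : {linear U -> V}).
Variables (Z : submodClosed U) (Z' : submodClosed V).
Hypothesis fZ : forall x, x \in Z -> f x \in Z'.

Definition sub_map (z : subsemimod Z) : subsemimod Z' :=
  Subsemimod (fZ (subsemimod_valP z)).

Lemma sub_map_semilinear : semilinear sub_map.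
Proof.
by split=> [a x|x y]; apply: val_inj; rewrite /= (linearZ, linearD).
Qed.

HB.instance Definition _ := GRing.isSemilinear.Build S (subsemimod Z)
  (subsemimod Z') *:%R sub_map sub_map_semilinear.

End RestrictedMap.

Section BourneMap.
Variables (S : pzSemiRingType) (U V : lSemiModType S) (f : {linear U -> V}).
Variables (N : submodClosed U) (N' : submodClosed V).
Hypothesis fN : forall x, x \in N -> f x \in N'.

(* fN is forced to be an argument so that the linear structure on bourne_map,
   which depends on it, can be inferred. *)
#[using="fN"]
Definition bourne_map (c : bourne_quot N) : bourne_quot N' :=
  \pi_(bourne_quot N') (f (repr c)).

Lemma bourne_map_pi x :
  bourne_map (\pi_(bourne_quot N) x) = \pi_(bourne_quot N') (f x).
Proof.
apply/eqP/bourne_quotP.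
case: (piP (bourne_quot N) x) => y /eqP/bourne_quotP[n [n' [Nn Nn' e]]].
(* The chosen representative [y] satisfies x + n = y + n'; the goal has [f y] on the left, so the
   witnesses are swapped. *)
by exists (f n'), (f n); rewrite -!linearD e !fN.
Qed.

Lemma bourne_map_semilinear : semilinear bourne_map.
Proof.
have piD W (K : submodClosed W) (x y : W) : \pi_(bourne_quot K) (x + y) =
    \pi_(bourne_quot K) x + \pi_(bourne_quot K) y.
  exact: bourne_pi_addP.
have piZ W (K : submodClosed W) a (x : W) : \pi_(bourne_quot K) (a *: x) =
    a *: \pi_(bourne_quot K) x.
  exact: bourne_pi_scaleP.
split=> [a x|x y]; first by rewrite -[x]reprK -piZ !bourne_map_pi linearZ piZ.
by rewrite -[x]reprK -[y]reprK -piD !bourne_map_pi linearD piD.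
Qed.

HB.instance Definition _ := GRing.isSemilinear.Build S (bourne_quot N)
  (bourne_quot N') *:%R bourne_map bourne_map_semilinear.

End BourneMap.

Section RadMapTheory.
Variable R : comPzRingType.
Implicit Types M : lmodType R.

Lemma radMap_mem M M' (f : {linear M -> M'}) (N : radSubmod M) x :
  (N : set M) x -> (radMap f N : set M') (f x).
Proof. by move=> Nx; apply: sub_rad; exists x. Qed.
Arguments radMap_mem [M M'] f [N x].

(** Radical images are left adjoint to preimages, and preimages of radical submodules are radical,
    so both sides lie below the same radical submodules. *)
Lemma radMap_comp M M' M'' (g : {linear M' -> M''}) (f : {linear M -> M'})
    (N : radSubmod M) :
  radMap (g \o f : {linear M -> M''}) N = radMap g (radMap f N).
Proof.
apply: radSubmod_eq_ub => K; split=> sub.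
  apply/radMap_sub.
  apply/(@radMap_sub _ _ _ f _ (RadSubmod (radical_preimage g (radSubmodP K)))).
  by move=> x /(radMap_mem (g \o f : {linear M -> M''})) /sub.
by apply/radMap_sub => x Nx; apply: sub; do 2!apply: radMap_mem.
Qed.

Lemma eq_radMap M M' (f g : {linear M -> M'}) : f =1 g -> radMap f =1 radMap g.
Proof.
move=> fg N; apply: radSubmod_eq_ub => K; rewrite !radMap_sub.
by split=> sub x /sub; rewrite /preimage /= fg.
Qed.

Lemma linear_rad0 M M' (f : {linear M -> M'}) (x : M) :
  ((0 : radSubmod M) : set M) x -> ((0 : radSubmod M') : set M') (f x).
Proof. by move=> x0; rewrite -(linear0 (radMap f)); apply: radMap_mem. Qed.

(** Since rad(0) is the least radical submodule, vanishing amounts to containment in it, which can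
    be tested on the elements f x. *)
Lemma radMap_eq0 M M' (f : {linear M -> M'}) (N : radSubmod M) :
  radMap f N = 0 <->
  forall x, (N : set M) x -> ((0 : radSubmod M') : set M') (f x).
Proof.
split=> [<- x|f0]; first exact: radMap_mem.
apply: radSubmod_eq; apply/seteqP; split; last exact: radSubmod_zero_sub.
exact/(@radMap_sub _ _ _ f N 0).
Qed.

End RadMapTheory.

Section HomologyMap.
Variables (R : comPzRingType) (M M' : complex R) (phi : complex_map M M').
Variable n : nat.

Lemma complex_map_cycles N : N \in cycles M n -> radMap (phi n) N \in cycles M' n.
Proof.
move=> /eqP/radMap_eq0 N0; apply/eqP; rewrite /= -radMap_comp.
(* Here f'(phi x) = phi(f x), and linear maps send rad(0) into rad(0). *)
by apply/radMap_eq0 => x /N0 /=; rewrite cmapP; apply: linear_rad0.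
Qed.

Definition cycles_map := sub_map complex_map_cycles.
HB.instance Definition _ := GRing.Linear.on cycles_map.

Lemma complex_map_boundaries z :
  z \in boundaries M n -> cycles_map z \in boundaries M' n.
Proof.
(* In degree n+1, [lower_map] computes to [phi n], so the boundary of L goes to the boundary of
   R(phi)(L). *)
rewrite !inE /= => -[L _ <-]; exists (radMap (phi n.+1) L) => //.
by rewrite -!radMap_comp; apply: eq_radMap => x /=; rewrite cmapP.
Qed.

Definition homology_map := bourne_map complex_map_boundaries.
HB.instance Definition _ := GRing.Linear.on homology_map.

End HomologyMap.

Arguments homology_map [R M M'] phi n.

Section HomologyTheory.
Variable R : comPzRingType.
Implicit Types M : complex R.

Lemma homology_map_id M n : homology_map (complex_id M) n =1 id.
Proof.
move=> c; rewrite -[c]reprK /homology_map bourne_map_pi.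
congr (\pi_(_) _); apply: val_inj; apply: radSubmod_eq_ub => K /=.
exact: radMap_sub.
Qed.

Lemma homology_map_comp M M' M'' (phi : complex_map M' M'')
    (psi : complex_map M M') n :
  homology_map (complex_comp phi psi) n =1
    homology_map phi n \o homology_map psi n.
Proof.
move=> c; rewrite /= -[c]reprK /homology_map !(bourne_map_pi _ (repr c)) bourne_map_pi.
by congr (\pi_(_) _); apply: val_inj => /=; apply: radMap_comp.
Qed.

Lemma homotopic_homology_map M M' (phi psi : complex_map M M') n :
  homotopic phi psi -> homology_map phi n =1 homology_map psi n.
Proof.
move=> [s phiE] c; rewrite -[c]reprK /homology_map !bourne_map_pi.
move: (repr c) => -[N NZ] {c}; apply/eqP/bourne_quotP.
pose B := radMap (cbd M' n.+1) (radMap (s n) N).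
pose b : subsemimod (cycles M' n) := Subsemimod (boundary_cycle (radMap (s n) N)).
have bB : b \in boundaries M' n by rewrite inE; exists (radMap (s n) N).
have Bs x : (N : set _) x -> (B : set _) (cbd M' n.+1 (s n x)).
  by move=> Nx; do 2!apply: radMap_mem.
(* Degree 0 needs no separate case: [lower_homotopy] is linear there too, being zero. *)
have sf0 x : (N : set _) x ->
    ((0 : radSubmod (M' n)) : set _) (lower_homotopy s n (cbd M n x)).
  move: NZ => /eqP/radMap_eq0 N0 /N0.
  exact: linear_rad0.
exists b, b; split=> //; apply: val_inj => /=.
rewrite -[LHS]/(radSubmod_add _ B) -[RHS]/(radSubmod_add _ B).
apply: radSubmod_eq_ub => K; rewrite !radSubmod_add_sub (radMap_sub (phi n)) (radMap_sub (psi n)).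
have sK := radSubmod_sub K.
(* Semimodules have no subtraction, but the submodule [K] of an actual module does, so terms in [K]
   can be cancelled. *)
have KN x y : (K : set _) x -> (K : set _) (y + x) -> (K : set _) y.
  move=> Kx Kyx; rewrite -[y](addrK x) -scaleN1r.
  by apply: submoduleD => //; apply: submoduleZ.
split=> -[NK BK]; split=> // x Nx; rewrite /preimage /=;
  have Ksf : (K : set _) _ := @radSubmod_zero_sub _ _ K _ (sf0 x Nx);
  have Kfs : (K : set _) _ := BK _ (Bs x Nx).
  rewrite -phiE; apply: submoduleD => //.
  by apply: submoduleD => //; apply: NK.
(* To recover phi x from psi x, the terms s f x and f' s x, both in [K], are cancelled. *)
by apply: (KN _ _ Ksf); apply: (KN _ _ Kfs); rewrite phiE; apply: NK.
Qed.

End HomologyTheory.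

Theorem corollary7 (R : comPzRingType) (M M' : complex R) :
  homotopy_equivalent M M' ->
  forall n : nat, isomorphic_semimod (homology M n) (homology M' n).
Proof.
move=> [phi [psi [phipsi psiphi]]] n; exists (homology_map phi n).
(* Each composite is induced by a map homotopic to the identity, hence is the identity on
   homology. *)
exists (homology_map psi n) => c.
  rewrite -[RHS]homology_map_id -(homotopic_homology_map psiphi).
  by rewrite homology_map_comp.
rewrite -[RHS]homology_map_id -(homotopic_homology_map phipsi).
by rewrite homology_map_comp.
Qed.
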